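(* Let $\eta\in\mathcal{C}(\mathbb{T})$ be a dual certificate of the primal problem $$\min_{m\in\mathcal{M}(\mathbb{T}),\ \tilde{\boldsymbol{\Phi}}(m)=\mathbf{y}_0}\|m\|_{TV}.$$ If the set of saturation points $\mathrm{Sat}(\eta)$ is finite, then any solution of the primal problem is a discrete measure with a number of Dirac impulses no greater than the number of saturation points of $\eta$. Moreover, the solution set of the primal problem is a convex and compact subset of the finite-dimensional vector space $$\mathrm{Span}\big(\{\text{Ш}(\cdot-\tau)\ :\ \tau\in\mathrm{Sat}(\eta)\}\big),$$ and, for any solution $m^\star=\sum_{\tau\in\mathrm{Sat}(\eta)}\beta_\tau\,\text{Ш}(\cdot-\tau)$, the signs of the (nonzero) weights $\beta_\tau$ are given by the signs of the associated saturation points, i.e. $\mathrm{sgn}(\beta_\tau)=\eta(\tau)\in\{-1,+1\}$ whenever $\beta_\tau\neq 0$.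
   Context: Let $T>0$ and $\mathbb{T}=\mathbb{R}/T\mathbb{Z}$. $\mathcal{C}(\mathbb{T})$ is the space of real continuous $T$-periodic functions with the sup norm $\|\cdot\|_\infty$; $\mathcal{M}(\mathbb{T})$ is the space of finite real periodic Radon measures (the dual of $\mathcal{C}(\mathbb{T})$), with total variation norm $\|m\|_{TV}=\sup\{\langle m,\varphi\rangle:\varphi\in\mathcal{C}(\mathbb{T}),\|\varphi\|_\infty\le 1\}$, $\langle m,\varphi\rangle=\int_{\mathbb{T}}\varphi\,\mathrm{d}m$. $\text{Ш}=\sum_{i\in\mathbb{Z}}\delta(\cdot-iT)$ is the $T$-periodic Dirac comb, so $\text{Ш}(\cdot-\tau)$ is the periodic Dirac impulse at $\tau\in\mathbb{T}$. $\mathcal{D}$ is an invertible linear, continuous, shift-invariant operator on the space $\mathcal{S}'(\mathbb{T})$ of periodic generalized functions, whose Green's function $\psi_{\mathcal{D}}=\mathcal{D}^{-1}\{\text{Ш}\}$ is a continuous real-valued $T$-periodic function (sampling-admissibility). Given sampling points $\theta_1,\dots,\theta_L\in\mathbb{T}$, the measurement operator is $\tilde{\boldsymbol{\Phi}}:\mathcal{M}(\mathbb{T})\to\mathbb{R}^L$, $\tilde{\boldsymbol{\Phi}}(m)=\big(\int_{\mathbb{T}}\psi_{\mathcal{D}}(\theta_\ell-t)\,\mathrm{d}m(t)\big)_{\ell=1,\dots,L}$, with adjoint $\tilde{\boldsymbol{\Phi}}^*:\mathbb{R}^L\to\mathcal{C}(\mathbb{T})$, $\tilde{\boldsymbol{\Phi}}^*\mathbf{h}=\sum_{\ell=1}^L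 h_\ell\,\psi_{\mathcal{D}}(\theta_\ell-\cdot)$. The data are $\mathbf{y}_0=\tilde{\boldsymbol{\Phi}}(m_0)$ for some $m_0\in\mathcal{M}(\mathbb{T})$. The associated dual problem is $\sup\{\langle\mathbf{y}_0,\mathbf{p}\rangle:\mathbf{p}\in\mathbb{R}^L,\ \|\tilde{\boldsymbol{\Phi}}^*\mathbf{p}\|_\infty\le1\}$. A function $\eta\in\mathcal{C}(\mathbb{T})$ is a dual certificate of the primal problem if: (i) $\eta$ belongs to the range of $\tilde{\boldsymbol{\Phi}}^*$; (ii) $\|\eta\|_\infty\le1$; (iii) for any solution $m^\star$ of the primal problem, $\langle m^\star,\eta\rangle=\|m^\star\|_{TV}$. Its set of saturation points is $\mathrm{Sat}(\eta)=\{t\in\mathbb{T}:\eta(t)=\pm1\}$. *)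

(* Defs.v *)
From HB Require Import structures.
From mathcomp Require Import all_boot all_order all_algebra finmap.
From mathcomp Require Import all_classical all_reals all_analysis.
From mathcomp Require Import ring_quotient measurable_realfun ring.
Set Implicit Arguments.
Unset Strict Implicit.
Unset Printing Implicit Defensive.
Import Order.TTheory GRing.Theory Num.Theory.
Import numFieldNormedType.Exports.
Local Open Scope classical_set_scope.
Local Open Scope ring_scope.

(* The subgroup TZ of R. *)
Definition periods (R : realType) (T : R) : {pred R} :=
  fun x => `[< exists k : int, x = k%:~R * T >].

Lemma periods_zmod_closed (R : realType) (T : R) : zmod_closed (periods T).
Proof.
split; first by apply/asboolP; exists 0; rewrite mul0r.
move=> x y /asboolP[k ->] /asboolP[l ->]; apply/asboolP; exists (k - l).
by rewrite intrB mulrBl.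
Qed.
HB.instance Definition _ (R : realType) (T : R) :=
  GRing.isZmodClosed.Build R (periods T) (periods_zmod_closed T).

(* R / TZ, with the quotient topology, the quotient group law and the Borel
   sigma-algebra; \pi_(torus T) is the projection from R. *)
Definition torus (R : realType) (T : R) : Type :=
  quotient_topology (Quotient.quot (periods T)).

HB.instance Definition _ (R : realType) (T : R) :=
  PointedTopological.copy (torus T)
    (quotient_topology (Quotient.quot (periods T))).
HB.instance Definition _ (R : realType) (T : R) :=
  Quotient.copy (torus T) (quotient_topology (Quotient.quot (periods T))).
HB.instance Definition _ (R : realType) (T : R) :=
  GRing.isZmodule.Build (torus T) (@Quotient.addqA R (periods T))
    (@Quotient.addqC R (periods T)) (@Quotient.add0q R (periods T))
    (@Quotient.addNq R (periods T)).
HB.instance Definition _ (R : realType) (T : R) :=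
  Measurable.copy (torus T) (g_sigma_algebraType (@open (torus T))).
Lemma pi_torusB (R : realType) (T : R) (x y : R) :
  (\pi_(torus T) (x - y) = \pi_(torus T) x - \pi_(torus T) y)%qT.
Proof. 
rewrite -[RHS]/(Quotient.add _ (Quotient.opp _)).
by rewrite -Quotient.pi_opp -Quotient.pi_add.
Qed.

Section Measures.
Context {R : realType} {T : R}.

(* A finite real measure is a real-valued, countably additive set function on the
   Borel sets; every such measure is Radon, R / TZ being compact and metrizable.
   Values outside the Borel sets are normalized to 0, so that equality of
   measures is equality on Borel sets. *)
Definition is_rmeasure (mu : set (torus T) -> R) : Prop :=
  [/\ mu set0 = 0,
      forall A, ~ measurable A -> mu A = 0 &
      semi_sigma_additive (fun A => (mu A)%:E)].

Definition rmeasure_pred : {pred set (torus T) -> R} :=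
  fun mu => `[< is_rmeasure mu >].

Lemma rmeasure_submod_closed : submod_closed rmeasure_pred.
Proof.
split.
  apply/asboolP; split=> // F mF tF mU /=.
  rewrite [X in X @ _ --> _](_ : _ = cst 0%E); first exact: cvg_cst.
  by apply/funext => n; rewrite big1.
move=> a mu nu /asboolP[mu0 muN mus] /asboolP[nu0 nuN nus].
apply/asboolP; split.
- by rewrite -[LHS]/(a * mu set0 + nu set0) mu0 nu0 mulr0 addr0.
- move=> A mA; rewrite -[LHS]/(a * mu A + nu A) (muN _ mA) (nuN _ mA).
  by rewrite mulr0 addr0.
- move=> F mF tF mU.
  rewrite [X in X @ _ --> _](_ : _ = (fun n =>
    a%:E * \sum_(0 <= i < n) (mu (F i))%:E +
    \sum_(0 <= i < n) (nu (F i))%:E)%E); last first.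
    apply/funext => n; rewrite fin_num_sume_distrr// -big_split/=.
    by apply: eq_bigr => i _; rewrite -EFinM -EFinD.
  rewrite -[X in _ --> X]/((a * mu (\bigcup_n F n) + nu (\bigcup_n F n))%:E).
  rewrite EFinD EFinM; apply: cvgeD => //; last exact: nus.
  by apply: cvgeZl => //; exact: mus.
Qed.

HB.instance Definition _ := GRing.isSubmodClosed.Build R
  (set (torus T) -> R) rmeasure_pred rmeasure_submod_closed.

End Measures.

Record measures (R : realType) (T : R) := Measures {
  measures_fun :> set (torus T) -> R;
  _ : measures_fun \in rmeasure_pred }.

HB.instance Definition _ (R : realType) (T : R) :=
  [isSub for @measures_fun R T].
HB.instance Definition _ (R : realType) (T : R) :=
  [Choice of measures T by <:].
HB.instance Definition _ (R : realType) (T : R) :=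
  [SubChoice_isSubLmodule of measures T by <:].

Section TotalVariation.
Context {R : realType} {T : R}.
Implicit Type m : measures T.

Definition charge_of m (A : set (torus T)) : \bar R := (m A)%:E.

Lemma charge_of0 m : charge_of m set0 = 0%E.
Proof. by case: m => m mP; have /asboolP[m0 _ _] := mP; congr EFin. Qed.

Lemma charge_of_fin m A : measurable A -> charge_of m A \is a fin_num.
Proof. by []. Qed.

Lemma charge_of_sigma_additive m : semi_sigma_additive (charge_of m).
Proof. by case: m => m mP; have /asboolP[] := mP. Qed.

HB.instance Definition _ m := isCharge.Build _ (torus T) R (charge_of m)
  (charge_of0 m) (@charge_of_fin m) (@charge_of_sigma_additive m).

Definition hahn_pos m : set (torus T) :=
  sval (cid (Hahn_decomposition (charge_of m))).
Definition hahn_neg m : set (torus T) :=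
  sval (cid (svalP (cid (Hahn_decomposition (charge_of m))))).

Lemma hahnP m : hahn_decomposition (charge_of m) (hahn_pos m) (hahn_neg m).
Proof. exact: svalP. Qed.

(* <m, phi>: the integral of phi against m = m+ - m-; the Jordan decomposition
   does not depend on the chosen Hahn decomposition. *)
Definition pairing m (phi : torus T -> R) : R :=
  \int[jordan_pos (hahnP m)]_t phi t - \int[jordan_neg (hahnP m)]_t phi t.

(* Extended real, hence meaningful without assuming that phi is bounded. *)
Definition supnorm (phi : torus T -> R) : \bar R :=
  ereal_sup (range (fun t => `|phi t|%:E)).

Definition tvnorm m : R :=
  sup [set pairing m phi | phi in
        [set phi | continuous phi /\ (supnorm phi <= 1)%E]].

Lemma supnorm_le1 phi : (supnorm phi <= 1)%E <-> forall t, `|phi t| <= 1.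
Proof.
split=> [h t|h].
  by rewrite -lee_fin (le_trans _ h)//; apply: ereal_sup_ubound; exists t.
by apply: ge_ereal_sup => _ [t _ <-]; rewrite lee_fin.
Qed.

Lemma torus_measurable_continuous (phi : torus T -> R) :
  continuous phi -> measurable_fun setT phi.
Proof.
move=> /continuousP cphi; apply: (measurability _ (RGenOpens.measurableE R)).
move=> _ [_ [a [b ->] <-]]; rewrite setTI; apply: sub_sigma_algebra.
exact/cphi/interval_open.
Qed.

Definition bmeas (phi : torus T -> R) :=
  measurable_fun setT phi /\ exists M, forall t, `|phi t| <= M.

Lemma bmeas_integrable (mu : {measure set (torus T) -> \bar R}) phi :
  (mu setT < +oo)%E -> bmeas phi -> mu.-integrable setT (EFin \o phi).
Proof.
move=> muT [mphi [M phiM]]; apply: measurable_bounded_integrable => //.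
exists M; split; first exact: num_real.
by move=> x Mx t _ /=; rewrite (le_trans (phiM t))// ltW.
Qed.

Lemma jordan_pos_fin m : (jordan_pos (hahnP m) setT < +oo)%E.
Proof. by rewrite ltey_eq fin_num_measure. Qed.

Lemma jordan_neg_fin m : (jordan_neg (hahnP m) setT < +oo)%E.
Proof. by rewrite ltey_eq fin_num_measure. Qed.

Lemma jordanE m A : measurable A ->
  (m A)%:E = (jordan_pos (hahnP m) A - jordan_neg (hahnP m) A)%E.
Proof.
move=> mA; rewrite -[LHS]/(charge_of m A) (jordan_decomp (hahnP m) mA).
by rewrite /cadd/= /cscale mulN1e.
Qed.

Lemma pairingE m (a b : {measure set (torus T) -> \bar R}) phi :
  (a setT < +oo)%E -> (b setT < +oo)%E ->
  (forall A, measurable A -> (m A)%:E = (a A - b A)%E) -> bmeas phi ->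
  pairing m phi = \int[a]_t phi t - \int[b]_t phi t.
Proof.
move=> aoo boo mab bphi.
have poo := jordan_pos_fin m; have noo := jordan_neg_fin m.
have mphi : measurable_fun (setT : set (torus T)) (fun t => (phi t)%:E) by apply/measurable_EFinP; case: bphi => mphi _.
have fin (mu : {measure set (torus T) -> \bar R}) A :
    (mu setT < +oo)%E -> measurable A -> mu A \is a fin_num.
  move=> muoo mA; rewrite ge0_fin_numE//; apply: le_lt_trans muoo.
  by apply: le_measure; rewrite ?inE.
set p := jordan_pos (hahnP m); set n := jordan_neg (hahnP m).
have H : (\int[measure_add p b]_t (phi t)%:E =
          \int[measure_add a n]_t (phi t)%:E)%E.
  apply: eq_measure_integral => A mA _.
  transitivity (p A + b A)%E; first exact: measure_addE.
  transitivity (a A + n A)%E; last by apply/esym; exact: measure_addE.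
  have := mab A mA; rewrite jordanE// -/p -/n.
  have := fin p A poo mA; have := fin n A noo mA.
  have := fin a A aoo mA; have := fin b A boo mA.
  case: (p A) (n A) (a A) (b A) => [x| |] [y| |] [z| |] [w| |]//= _ _ _ _.
  by move=> [xyzw]; congr (_%:E); rewrite -(subrK y x) xyzw addrAC subrK addrC [in RHS]addrC//; rewrite addrC.
move: H; have I mu := @bmeas_integrable mu phi.
rewrite !integral_measure_add//; try by exact: I.
rewrite /pairing /Rintegral -/p -/n => H.
have : forall mu : {measure set (torus T) -> \bar R}, (mu setT < +oo)%E ->
  (\int[mu]_t (phi t)%:E)%E \is a fin_num.
  by move=> mu muoo; apply: integrable_fin_num => //; exact: I.
move=> J; move: (J p poo) (J n noo) (J a aoo) (J b boo) H.
do 4 case: integral => [?| |]//=; move=> _ _ _ _ [].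
move=> h; apply/eqP; rewrite subr_eq addrAC eq_sym subr_eq eq_sym; apply/eqP.
by [].
Qed.

End TotalVariation.

Section TVnorm.
Context {R : realType} {T : R}.
Implicit Type m : measures T.

Lemma unit_ball_bmeas (phi : torus T -> R) :
  continuous phi -> (supnorm phi <= 1)%E -> bmeas phi.
Proof.
move=> cphi /supnorm_le1 phi1; split; last by exists 1.
exact: torus_measurable_continuous.
Qed.

Lemma RintegralDm (a b : {measure set (torus T) -> \bar R}) (phi : torus T -> R) :
  (a setT < +oo)%E -> (b setT < +oo)%E -> bmeas phi ->
  \int[measure_add a b]_t phi t = \int[a]_t phi t + \int[b]_t phi t.
Proof.
move=> aoo boo bphi.
have mphi : measurable_fun (setT : set (torus T)) (EFin \o phi).
  by apply/measurable_EFinP; case: bphi.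
have I mu := @bmeas_integrable R T mu phi.
rewrite /Rintegral integral_measure_add//; try exact: I.
by rewrite fineD//; apply: integrable_fin_num => //; exact: I.
Qed.

Lemma measure_add_fin (a b : {measure set (torus T) -> \bar R}) :
  (a setT < +oo)%E -> (b setT < +oo)%E -> (measure_add a b setT < +oo)%E.
Proof.
move=> aoo boo; rewrite [X in (X < _)%E](_ : _ = (a setT + b setT)%E).
  exact: lte_add_pinfty.
exact: measure_addE.
Qed.

Lemma pairingD m1 m2 (phi : torus T -> R) : bmeas phi ->
  pairing (m1 + m2) phi = pairing m1 phi + pairing m2 phi.
Proof.
move=> bphi.
rewrite (@pairingE _ _ (m1 + m2)
  (measure_add (jordan_pos (hahnP m1)) (jordan_pos (hahnP m2)))
  (measure_add (jordan_neg (hahnP m1)) (jordan_neg (hahnP m2))))//.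
- rewrite !RintegralDm ?jordan_pos_fin ?jordan_neg_fin//.
  by rewrite /pairing opprD addrACA.
- by apply: measure_add_fin; exact: jordan_pos_fin.
- by apply: measure_add_fin; exact: jordan_neg_fin.
- move=> A mA; transitivity ((m1 A)%:E + (m2 A)%:E)%E => //.
  rewrite !jordanE//.
  set p1 := jordan_pos (hahnP m1); set p2 := jordan_pos (hahnP m2).
  set n1 := jordan_neg (hahnP m1); set n2 := jordan_neg (hahnP m2).
  transitivity ((p1 A + p2 A) - (n1 A + n2 A))%E.
    by rewrite fin_num_oppeD ?fin_num_measure// addeACA.
  by congr (_ - _)%E; apply/esym; exact: measure_addE.
Qed.

Lemma pairingN m (phi : torus T -> R) : bmeas phi ->
  pairing (- m) phi = - pairing m phi.
Proof.
move=> bphi.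
rewrite (@pairingE _ _ (- m) (jordan_neg (hahnP m)) (jordan_pos (hahnP m)))//.
- by rewrite /pairing opprB.
- exact: jordan_neg_fin.
- exact: jordan_pos_fin.
- move=> A mA; transitivity (- (m A)%:E)%E => //.
  by rewrite jordanE// fin_num_oppeB ?fin_num_measure// addeC.
Qed.

Lemma RintegralZm (r : {nonneg R}) (a : {measure set (torus T) -> \bar R}) (phi : torus T -> R) :
  (a setT < +oo)%E -> bmeas phi ->
  \int[mscale r a]_t phi t = r%:num * \int[a]_t phi t.
Proof.
move=> aoo bphi.
have mphi : measurable_fun (setT : set (torus T)) (EFin \o phi).
  by apply/measurable_EFinP; case: bphi.
have I := @bmeas_integrable R T a phi aoo bphi.
rewrite /Rintegral integralE [in RHS]integralE.
rewrite !ge0_integral_mscale//; try exact: measurable_funepos;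
  try exact: measurable_funeneg.
rewrite -muleBr//; last by apply: fin_num_adde_defl;
  rewrite fin_numN; exact: integrable_neg_fin_num.
rewrite fineM// fin_numB integrable_pos_fin_num ?integrable_neg_fin_num//.
Qed.

Lemma pairingZ r m (phi : torus T -> R) : bmeas phi ->
  pairing (r *: m) phi = r * pairing m phi.
Proof.
move=> bphi.
wlog r0 : r m / 0 <= r.
  move=> h; have [/h//|/ltW r0] := leP 0 r.
  have := h (- r) (- m); rewrite oppr_ge0 => /(_ r0).
  by rewrite scalerN scaleNr opprK pairingN// mulrNN.
pose q := NngNum r0.
rewrite (@pairingE _ _ (r *: m) (mscale q (jordan_pos (hahnP m)))
   (mscale q (jordan_neg (hahnP m))))//.
- by rewrite !RintegralZm ?jordan_pos_fin ?jordan_neg_fin// /pairing mulrBr.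
- by rewrite /mscale lte_mul_pinfty// jordan_pos_fin.
- by rewrite /mscale lte_mul_pinfty// jordan_neg_fin.
- move=> A mA; transitivity (r%:E * (m A)%:E)%E => //.
  by rewrite jordanE// /mscale/= muleBr// fin_num_adde_defl// fin_numN fin_num_measure.
Qed.

Definition unit_ball : set (torus T -> R) :=
  [set phi | continuous phi /\ (supnorm phi <= 1)%E].

Lemma cst0_unit_ball : unit_ball (fun=> 0).
Proof.
split; [exact: cst_continuous|apply/supnorm_le1 => t; by rewrite normr0 ler01].
Qed.

Lemma pairing0f m : pairing m (fun=> 0) = 0.
Proof.
rewrite /pairing /Rintegral.
by rewrite !integral0/= subrr.
Qed.

Lemma pairing_le m (phi : torus T -> R) : unit_ball phi ->
  pairing m phi <= fine (jordan_pos (hahnP m) setT) + fine (jordan_neg (hahnP m) setT).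
Proof.
move=> -[cphi phi1]; have bphi := unit_ball_bmeas cphi phi1.
have /supnorm_le1 {}phi1 := phi1.
have aux (mu : {measure set (torus T) -> \bar R}) : (mu setT < +oo)%E ->
    `|\int[mu]_t phi t| <= fine (mu setT).
  move=> muoo; have I := bmeas_integrable muoo bphi.
  apply: (le_trans (le_normr_Rintegral _ _)) => //.
  have -> : fine (mu setT) = \int[mu]_t 1 by rewrite Rintegral_cst// mul1r.
  apply: le_Rintegral => //; first exact: integrable_norm.
  by apply: bmeas_integrable => //; split => //; exists 1 => t; rewrite normr1.
rewrite /pairing (le_trans (ler_norm _))// (le_trans (ler_normB _ _))// lerD//.
- exact/aux/jordan_pos_fin.
- exact/aux/jordan_neg_fin.
Qed.

Lemma tv_has_sup m : has_sup [set pairing m phi | phi in unit_ball].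
Proof.
split; first by exists (pairing m (fun=> 0)); exists (fun=> 0) => //; exact: cst0_unit_ball.
eexists => _ [phi bphi <-]; exact: pairing_le.
Qed.

Lemma pairing_le_tv m phi : unit_ball phi -> pairing m phi <= tvnorm m.
Proof. by move=> Bphi; apply: (sup_upper_bound (tv_has_sup m)); exists phi. Qed.

Lemma tvnormD m1 m2 : tvnorm (m1 + m2) <= tvnorm m1 + tvnorm m2.
Proof.
apply: sup_le_ub; first exact: (tv_has_sup _).1.
move=> _ [phi Bphi <-]; rewrite pairingD; last exact: (unit_ball_bmeas Bphi.1 Bphi.2).
by rewrite lerD// pairing_le_tv.
Qed.

Lemma tvnorm0 : tvnorm (0 : measures T) = 0.
Proof.
rewrite /tvnorm [X in sup X](_ : _ = [set 0]) ?sup1//.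
apply/seteqP; split=> [_ [phi Bphi <-]|_ ->].
  have bphi := unit_ball_bmeas Bphi.1 Bphi.2.
  by rewrite -(scale0r (0 : measures T)) pairingZ// mul0r.
exists (fun=> 0); [exact: cst0_unit_ball|exact: pairing0f].
Qed.

Lemma tvnorm_ge0 m : 0 <= tvnorm m.
Proof. by rewrite -(pairing0f m) pairing_le_tv//; exact: cst0_unit_ball. Qed.

Lemma tvnormZ_le r m : tvnorm (r *: m) <= `|r| * tvnorm m.
Proof.
apply: sup_le_ub; first exact: (tv_has_sup _).1.
move=> _ [phi Bphi <-]; have bphi := unit_ball_bmeas Bphi.1 Bphi.2.
rewrite pairingZ//; have [r0|r0] := leP 0 r.
  by rewrite ger0_norm// ler_wpM2l// pairing_le_tv.
have -> : r * pairing m phi = `|r| * pairing (- m) phi.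
  by rewrite pairingN// ltr0_norm// mulrNN.
rewrite ler_wpM2l// pairingN// -mulN1r.
have -> : -1 * pairing m phi = pairing m (fun t => - phi t).
  have aux (mu : {measure set (torus T) -> \bar R}) : (mu setT < +oo)%E ->
      \int[mu]_t (- phi t) = -1 * \int[mu]_t phi t.
    move=> muoo; rewrite -RintegralZl//; last exact: bmeas_integrable.
    by apply: eq_Rintegral => t _; rewrite mulN1r.
  rewrite /pairing !aux ?mulrBr//; first exact: jordan_neg_fin.
  exact: jordan_pos_fin.
apply: pairing_le_tv; split.
  by move=> t; apply: continuousN; case: Bphi => + _; exact.
by apply/supnorm_le1 => t; rewrite normrN; move/supnorm_le1: Bphi.2.
Qed.

Lemma tvnormZ r m : tvnorm (r *: m) = `|r| * tvnorm m.
Proof.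
apply/eqP; rewrite eq_le tvnormZ_le/=.
have [->|r0] := eqVneq r 0; first by rewrite normr0 mul0r tvnorm_ge0.
rewrite -ler_pdivlMl ?normr_gt0// -normfV.
by rewrite -{1}(scale1r m) -(mulVf r0) -scalerA tvnormZ_le.
Qed.
End TVnorm.

Section Definiteness.
Context {R : realType} {T : R}.
Implicit Type m : measures T.

Lemma open_bump (U : set (torus T)) : open U ->
  exists phi : nat -> torus T -> R, (forall n, unit_ball (phi n)) /\
    forall t, phi n t @[n --> \oo] --> (\1_U t : R).
Proof.
move=> oU; pose B : set R := ~` (\pi_(torus T) @^-1` U)%qT.
have [B0|/set0P B0] := eqVneq B set0.
  exists (fun _ _ => 1); split.
    move=> n; split; first exact: cst_continuous.
    by apply/supnorm_le1 => t; rewrite normr1.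
  move=> t; rewrite indicE mem_set; first exact: cvg_cst.
  apply: contrapT => Ut; have : B (repr t) by rewrite /B/= reprK.
  by rewrite B0.
have oB : open (~` B) by rewrite setCK; exact: oU.
pose d x := inf [set `|x - b| | b in B].
have hi x : has_inf [set `|x - b| | b in B].
  split; first by have [b Bb] := B0; exists `|x - b|; exists b.
  by exists 0 => _ [b _ <-].
have dle x b : B b -> d x <= `|x - b|.
  by move=> Bb; apply: inf_lbound; [exact: (hi x).2|exists b].
have dlb x e : (forall b, B b -> e <= `|x - b|) -> e <= d x.
  by move=> h; apply: lb_le_inf; [exact: (hi x).1|move=> _ [b Bb <-]; exact: h].
have d0 x : 0 <= d x by apply: dlb.
have dL x y : d x <= `|x - y| + d y.
  rewrite -lerBlDl; apply: dlb => b Bb; rewrite lerBlDl.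
  by rewrite (le_trans (dle x b Bb))// ler_distD.
have dcont : continuous d.
  move=> x; apply/cvgrPdist_le => e e0; near=> y.
  have xy : `|x - y| <= e.
    near: y; exact: (@cvgr_dist_le _ _ _ (nbhs x) _ id x (@cvg_id _ _) e e0).
  rewrite ler_norml; apply/andP; split.
    by rewrite lerNl opprB lerBlDr (le_trans (dL y x))// distrC lerD2r.
  by rewrite lerBlDr (le_trans (dL x y))// lerD2r.
have dper x y : (\pi_(torus T) x = \pi_(torus T) y)%qT -> d x = d y.
  suff h z w : (\pi_(torus T) z = \pi_(torus T) w)%qT -> d z <= d w.
    by move=> xy; apply/eqP; rewrite eq_le !h.
  move=> zw; apply: dlb => b Bb.
  have Bb' : B (z - (w - b)).
    by rewrite /B/= !pi_torusB zw opprB addrCA subrr addr0.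
  by rewrite (le_trans (dle _ _ Bb'))// opprB addrC subrK.
have dB x : B x -> d x = 0.
  by move=> Bx; apply/eqP; rewrite eq_le d0 andbT (le_trans (dle _ _ Bx))// subrr normr0.
have dpos x : ~ B x -> 0 < d x.
  move=> Bx; have /open_nbhs_nbhs/nbhs_ballP[e /= e0 eB] : open_nbhs x (~` B) by [].
  apply: (lt_le_trans e0); apply: dlb => b Bb; rewrite leNgt; apply/negP => xb.
  exact: (eB b).
pose psi n x := Num.min 1 (n%:R * d x).
exists (fun n t => psi n (repr t)); split.
  move=> n; split; last first.
    apply/supnorm_le1 => t; rewrite ger0_norm ?ge_min ?lexx//.
    by rewrite le_min ler01 mulr_ge0.
  apply: (@repr_comp_continuous _ (Quotient.quot (periods T)) _ (psi n)).
    move=> x; apply: (@continuous_min R R (cst 1) (fun x => n%:R * d x)).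
      exact: cst_continuous.
    by apply: continuousM; [exact: cst_continuous|exact: dcont].
  move=> x y /eqP xy; apply/eqP; rewrite /psi (dper x y)//.
move=> t; rewrite indicE.
case: (boolP (t \in U)) => [/set_mem Ut|/negP Ut].
  have dt : 0 < d (repr t) by apply: dpos; rewrite /B/= reprK; exact.
  apply: cvg_near_cst; near=> n; rewrite /psi.
  apply/min_l.
  rewrite -ler_pdivrMr//; near: n; exact: nbhs_infty_ger.
rewrite (_ : (fun _ => _) = fun=> 0); first exact: cvg_cst.
apply/funext => n; rewrite /psi dB ?mulr0 ?min_r//.
by rewrite /B/= reprK => /mem_set.
Unshelve. all: by end_near. Qed.

Lemma Rintegral_open (mu : {measure set (torus T) -> \bar R}) (U : set (torus T))
    (phi : nat -> torus T -> R) : (mu setT < +oo)%E -> open U ->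
    (forall n, unit_ball (phi n)) -> (forall t, phi n t @[n --> \oo] --> (\1_U t : R)) ->
  (\int[mu]_t phi n t)%R @[n --> \oo] --> fine (mu U).
Proof.
move=> muoo oU Bphi phiU.
have mU : measurable U by exact: sub_sigma_algebra.
have bphi n : bmeas (phi n) by case: (Bphi n) => ? ?; exact: unit_ball_bmeas.
have I n := bmeas_integrable muoo (bphi n).
have := @dominated_convergence _ (torus T) R mu setT measurableT
  (fun n t => (phi n t)%:E) (fun t => (\1_U t)%:E) (cst 1%E).
case.
- by move=> n; apply/measurable_EFinP; exact: (bphi n).1.
- by apply/measurable_EFinP; exact: measurable_indic.
- by apply: aeW => t _; apply/cvg_EFin; [exact: nearW|exact: phiU].
- rewrite (_ : cst 1%E = EFin \o (cst 1 : torus T -> R))//.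
  apply: bmeas_integrable => //; split; first exact: measurable_cst.
  by exists 1 => t; rewrite normr1.
- apply: aeW => t n _; rewrite lee_fin.
  by have [_ /supnorm_le1] := Bphi n; exact.
move=> _ _; rewrite integral_indic// setIT => h.
apply: fine_cvg; rewrite fineK//.
by rewrite ge0_fin_numE//; apply: le_lt_trans muoo; apply: le_measure; rewrite ?inE.
Qed.

Lemma tvnorm_eq0 m : tvnorm m = 0 -> m = 0.
Proof.
move=> m0.
have P0 phi : unit_ball phi -> pairing m phi = 0.
  move=> Bphi; apply/eqP; rewrite eq_le -{1}m0 pairing_le_tv//=.
  have := pairing_le_tv (- m) Bphi.
  rewrite -scaleN1r tvnormZ m0 mulr0 pairingZ.
    by rewrite mulN1r oppr_le0.
  exact: (unit_ball_bmeas Bphi.1 Bphi.2).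
set p := jordan_pos (hahnP m); set n := jordan_neg (hahnP m).
have pn A : measurable A -> p A = n A.
  apply: (@measure_unique _ R (torus T) open (fun=> setT) erefl _ _ _ p n) => //.
  - exact: openI.
  - by move=> _; exact: openT.
  - by rewrite bigcup_const.
  - move=> U oU; have [phi [Bphi phiU]] := open_bump oU.
    have mU : measurable U by exact: sub_sigma_algebra.
    have hp := Rintegral_open (jordan_pos_fin m) oU Bphi phiU.
    have hn := Rintegral_open (jordan_neg_fin m) oU Bphi phiU.
    have hpn : (fun k => \int[p]_t phi k t) = (fun k => \int[n]_t phi k t).
      by apply/funext => k; apply/eqP; rewrite -subr_eq0 -/(pairing m _) P0.
    rewrite -[LHS]fineK ?fin_num_measure// -[RHS]fineK ?fin_num_measure//.
    congr EFin; apply: (cvg_unique _ hp) => //.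
    by rewrite -/p hpn.
  - by move=> _; exact: jordan_pos_fin.
apply/val_inj/funext => A /=.
have [mA|mA] := pselect (measurable A).
  have := jordanE m mA; rewrite -/p -/n pn// subee ?fin_num_measure//.
  by case.
by case: m {m0 P0 p n pn} => m mP/=; have /asboolP[_ + _] := mP; exact.
Qed.

End Definiteness.

(* From here on, measures T is a normed module, with `|m| = tvnorm m and the
   topology of the total variation norm. *)
HB.instance Definition _ (R : realType) (T : R) :=
  Lmodule_isNormed.Build R (measures T) (@tvnormD R T) (@tvnormZ R T)
    (@tvnorm_eq0 R T).

Section TestFunctions.
Context {R : realType} {T : R}.

(* The T-periodic function on R corresponding to a function on R / TZ. *)
Definition unroll (f : torus T -> R) : R -> R := f \o \pi_(torus T)%qT.

Definition smooth (f : torus T -> R) : Prop :=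
  forall k x, derivable (derive1n k (unroll f)) x 1.

Definition smooth_pred : {pred torus T -> R} := fun f => `[< smooth f >].

Lemma derive1n_linear (a : R) (f g : torus T -> R) : smooth f -> smooth g ->
  forall k, derive1n k (unroll (a *: f + g)) =
    a \*: derive1n k (unroll f) + derive1n k (unroll g).
Proof.
move=> sf sg; elim=> [//|k IH]; rewrite !derive1nS IH.
apply/funext => x; rewrite -[RHS]/(a *: _ + _) !derive1E deriveD//.
  by rewrite deriveZ.
exact: derivableZ.
Qed.

Lemma smooth_submod_closed : submod_closed smooth_pred.
Proof.
split.
  apply/asboolP => k x; rewrite (_ : derive1n k _ = cst 0); first exact: derivable_cst.
  elim: k => [//|k IH]; rewrite derive1nS IH.
  by apply/funext => y; rewrite derive1_cst.
move=> a f g /asboolP sf /asboolP sg; apply/asboolP => k x.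
by rewrite derive1n_linear//; apply: derivableD => //; exact: derivableZ.
Qed.

HB.instance Definition _ := GRing.isSubmodClosed.Build R
  (torus T -> R) smooth_pred smooth_submod_closed.

End TestFunctions.

Record testfun (R : realType) (T : R) := TestFun {
  testfun_fun :> torus T -> R;
  _ : testfun_fun \in smooth_pred }.

HB.instance Definition _ (R : realType) (T : R) :=
  [isSub for @testfun_fun R T].
HB.instance Definition _ (R : realType) (T : R) :=
  [Choice of testfun T by <:].
HB.instance Definition _ (R : realType) (T : R) :=
  [SubChoice_isSubLmodule of testfun T by <:].

(* The Frechet topology of test functions: uniform convergence of the
   derivatives of every order. *)
Definition jets (R : realType) (T : R) (f : testfun T) :
    {ptws nat -> {uniform R -> R}} :=
  fun k => derive1n k (unroll f).

HB.instance Definition _ (R : realType) (T : R) :=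
  Topological.copy (testfun T) (initial_topology (@jets R T)).

Lemma cvg_initial (S : choiceType) (U : topologicalType) (f : S -> U)
    (F : set_system S) (s : S) : Filter F ->
  f y @[y --> F] --> f s -> F --> (s : initial_topology f).
Proof.
move=> FF Fs P; rewrite nbhsE => -[_ [[B oB <-] fs] BP].
apply: (filterS BP); apply: Fs; exact: open_nbhs_nbhs.
Qed.

Lemma cvg_ptws (V : topologicalType) (F : set_system {ptws nat -> V})
    (g : {ptws nat -> V}) : Filter F ->
  (forall k, h k @[h --> F] --> g k) -> F --> g.
Proof. by move=> FF Fg; apply/cvg_sup => k; apply: cvg_initial; exact: Fg. Qed.

Section Translation.
Context {R : realType} {T : R}.

Lemma derive1n_translate (g : R -> R) (s : R) k :
  derive1n k (fun x => g (x + s)) = (fun x => derive1n k g (x + s)).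
Proof.
elim: k => [//|k IH]; rewrite !derive1nS IH; apply/funext => x.
rewrite /derive1; apply: (congr1 (fun F : R -> R => lim (F @ 0^'))).
by apply/funext => h; rewrite -addrA.
Qed.

Lemma unroll_translate (f : torus T -> R) (tau : torus T) :
  unroll (fun t => f (t + tau)) = (fun x => unroll f (x + repr tau)).
Proof.
apply/funext => x; rewrite /unroll/=; congr f.
by rewrite -[repr tau]opprK pi_torusB -(sub0r (repr tau)) pi_torusB !opprB reprK
  -[in RHS](subrr 0) pi_torusB subrr subr0.
Qed.

Lemma smooth_translate (f : testfun T) (tau : torus T) :
  (fun t => f (t + tau)) \in smooth_pred.
Proof.
have /asboolP sf : (f : torus T -> R) \in smooth_pred by case: f.
apply/asboolP => k x; rewrite unroll_translate derive1n_translate.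
have := sf k (x + repr tau); rewrite /derivable.
set F1 := (F1 in cvg (F1 @ _)); set F2 := (F2 in _ -> cvg (F2 @ _)).
suff -> : F1 = F2 by [].
by apply/funext => h; rewrite /F1 /F2/= addrA.
Qed.

Definition translate (tau : torus T) (f : testfun T) : testfun T :=
  TestFun (smooth_translate f tau).

Lemma translate_continuous tau : continuous (translate tau).
Proof.
pose S (g : {ptws nat -> {uniform R -> R}}) : {ptws nat -> {uniform R -> R}} :=
  fun k x => g k (x + repr tau).
have Sc : continuous S.
  move=> g; apply: cvg_ptws; first by apply: fmap_filter; exact: nbhs_filter.
  move=> k.
  have pk : proj k h @[h --> g] --> proj k g.
    exact: (@proj_continuous nat (fun=> {uniform R -> R}) k g).
  move=> P /uniform_nbhs[E [entE EP]].
  pose Q : set {uniform R -> R} := [set h | forall y, E (g k y, h y)].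
  have nQ : nbhs (proj k g : {uniform R -> R}) Q.
    by apply/uniform_nbhs; exists E; split => // h hE y; exact: hE.
  apply: (@filterS _ _ (nbhs_filter g) (proj k @^-1` Q)); last exact: (pk _ nQ).
  by move=> h hE; apply: EP => y _; exact: hE.
apply/continuousP => _ [A oA <-].
exists (S @^-1` A); first by move/continuousP: Sc; exact.
have jt f : jets (translate tau f) = S (jets f).
  apply/funext => k; rewrite /jets.
  by rewrite -[LHS]/(derive1n k (unroll (fun t => f (t + tau)))) unroll_translate
    derive1n_translate.
by apply/seteqP; split => f; rewrite /preimage/= jt.
Qed.

Lemma eval_continuous (t : torus T) : continuous (fun f : testfun T => f t).
Proof.
move=> f.
have jc : jets g @[g --> f] --> jets f by exact: initial_continuous.
have pk : proj 0%N h @[h --> jets f] --> proj 0%N (jets f).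
  exact: (@proj_continuous nat (fun=> {uniform R -> R}) 0%N (jets f)).
move=> P /nbhs_ballP[e e0 eP].
pose Q : set {uniform R -> R} := [set h | forall y, ball (unroll f y) e (h y)].
have nQ : nbhs (proj 0%N (jets f) : {uniform R -> R}) Q.
  apply/uniform_nbhs; exists [set xy | ball xy.1 e xy.2]; split.
    exact: (@entourage_ball _ _ (PosNum e0)).
  by move=> h hE y; exact: hE.
apply: (@filterS _ _ (nbhs_filter f) _ _ _ (jc _ (pk _ nQ))) => g gQ.
apply: eP; have : Q (unroll g) by exact: gQ.
by move=> /(_ (repr t)); rewrite /unroll/= reprK.
Qed.

End Translation.

Section Distributions.
Context {R : realType} {T : R}.

Definition is_pgf (u : testfun T -> R) : Prop :=
  (forall (a : R) (f g : testfun T), u (a *: f + g) = a * u f + u g) /\ continuous u.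

Definition pgf_pred : {pred testfun T -> R} := fun u => `[< is_pgf u >].

Lemma pgf_submod_closed : submod_closed pgf_pred.
Proof.
split.
  apply/asboolP; split; last exact: cst_continuous.
  by move=> a f g; rewrite -[LHS]/0 -[RHS]/(a * 0 + 0) mulr0 addr0.
move=> a u v /asboolP[ul uc] /asboolP[vl vc]; apply/asboolP; split.
  move=> b f g.
  rewrite -[LHS]/(a * u (b *: f + g) + v (b *: f + g)).
  rewrite -[RHS]/(b * (a * u f + v f) + (a * u g + v g)).
  by rewrite ul vl; ring.
move=> f.
have cu : {for f, continuous (fun x => a * u x)}.
  by apply: continuousM; [exact: cst_continuous|exact: uc].
exact: (continuousD cu (vc f)).
Qed.

HB.instance Definition _ := GRing.isSubmodClosed.Build R
  (testfun T -> R) pgf_pred pgf_submod_closed.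

End Distributions.

(* Periodic generalized functions: continuous linear forms on test functions. *)
Record pgf (R : realType) (T : R) := Pgf {
  pgf_fun :> testfun T -> R;
  _ : pgf_fun \in pgf_pred }.

HB.instance Definition _ (R : realType) (T : R) := [isSub for @pgf_fun R T].
HB.instance Definition _ (R : realType) (T : R) := [Choice of pgf T by <:].
HB.instance Definition _ (R : realType) (T : R) :=
  [SubChoice_isSubLmodule of pgf T by <:].

(* The weak-* topology on periodic generalized functions. *)
HB.instance Definition _ (R : realType) (T : R) :=
  Topological.copy (pgf T)
    (initial_topology (@pgf_fun R T : pgf T -> {ptws testfun T -> R})).

Section Operators.
Context {R : realType} {T : R}.

Lemma pgf_shift_subproof (tau : torus T) (u : pgf T) :
  (fun f => u (translate tau f)) \in pgf_pred.
Proof.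
case: u => u uP; have /asboolP[ul uc] := uP; apply/asboolP; split=> [a f g|f] /=.
  by rewrite -ul; congr u; exact: val_inj.
exact: (continuous_comp (@translate_continuous R T tau f) (uc _)).
Qed.

(* u(. - tau), defined by duality. *)
Definition pgf_shift (tau : torus T) (u : pgf T) : pgf T :=
  Pgf (pgf_shift_subproof tau u).

Definition shift_invariant (D : pgf T -> pgf T) : Prop :=
  forall (tau : torus T) (u : pgf T), D (pgf_shift tau u) = pgf_shift tau (D u).

Lemma pgf_comb_subproof : (fun f : testfun T => f 0) \in pgf_pred.
Proof. by apply/asboolP; split=> // f; exact: eval_continuous. Qed.

(* The Dirac comb III, as a generalized function. *)
Definition pgf_comb : pgf T := Pgf pgf_comb_subproof.

(* u is the function psi: <u, f> is the integral of psi f over one period. *)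
Definition represented_by (u : pgf T) (psi : torus T -> R) : Prop :=
  forall f : testfun T,
    u f = \int[lebesgue_measure]_(x in `[0, T]) (unroll psi x * unroll f x).

Definition is_green (D : pgf T -> pgf T) (psi : torus T -> R) : Prop :=
  exists2 u, D u = pgf_comb & represented_by u psi.

End Operators.

Section DiracImpulse.
Context {R : realType} {T : R}.

Definition impulse_fun (tau : torus T) (A : set (torus T)) : R :=
  if A \in measurable then \1_A tau else 0.

Lemma impulse_subproof (tau : torus T) : impulse_fun tau \in rmeasure_pred.
Proof.
apply/asboolP; split.
- by rewrite /impulse_fun indic0 if_same.
- by move=> A mA; rewrite /impulse_fun memNset.
- move=> F mF tF mU.
  have dE A : measurable A -> (impulse_fun tau A)%:E = \d_tau A :> \bar R.
    by move=> mA; rewrite /impulse_fun mem_set// diracE indicE.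
  rewrite dE//; under eq_fun do under eq_bigr do rewrite dE//.
  exact: measure_semi_sigma_additive.
Qed.

(* The periodic Dirac impulse III(. - tau), as a measure. *)
Definition impulse (tau : torus T) : measures T :=
  Measures (impulse_subproof tau).

End DiracImpulse.

Section Problem.
Context {R : realType} {T : R} {L : nat}.
Variables (psi : torus T -> R) (theta : 'I_L -> torus T).

Definition Phi (m : measures T) : 'rV[R]_L :=
  \row_l pairing m (fun t => psi (theta l - t)).

Definition Phi_adj (h : 'rV[R]_L) : torus T -> R :=
  fun t => \sum_(l < L) h 0 l * psi (theta l - t).

Definition primal_solutions (y0 : 'rV[R]_L) : set (measures T) :=
  [set m | Phi m = y0 /\ forall m', Phi m' = y0 -> `|m| <= `|m'|].

Definition dual_certificate (y0 : 'rV[R]_L) (eta : torus T -> R) : Prop :=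
  [/\ continuous eta,
      exists h, eta = Phi_adj h,
      (supnorm eta <= 1)%E &
      forall m, primal_solutions y0 m -> pairing m eta = `|m|].

End Problem.

Definition Sat (R : realType) (T : R) (eta : torus T -> R) : set (torus T) :=
  [set t | eta t = 1 \/ eta t = -1].

Definition lin_span (R : realType) (V : lmodType R) (A : set V) : set V :=
  [set v | exists (n : nat) (a : 'I_n -> R) (x : 'I_n -> V),
    (forall i, A (x i)) /\ v = \sum_(i < n) a i *: x i].

(* Main.v *)
Require Import Defs.
From HB Require Import structures.
From mathcomp Require Import all_boot all_order all_algebra finmap.
From mathcomp Require Import all_classical all_reals all_analysis.
From mathcomp Require Import ring_quotient measurable_realfun ring.
Set Implicit Arguments.
Unset Strict Implicit.
Unset Printing Implicit Defensive.
Import Order.TTheory GRing.Theory Num.Theory.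
Import numFieldNormedType.Exports.
Local Open Scope classical_set_scope.
Local Open Scope ring_scope.

(** Let eta be a dual certificate and m a solution, so that eta lies in the unit
    ball of continuous functions and attains the norm: <m, eta> = |m|.

    Since eta is a maximizer of <m, .> over the unit ball, every direction in
    which eta can be moved both ways inside the ball is a direction on which m
    vanishes. The functions f with |f| <= c (1 - |eta|) are such directions, up
    to scaling ([pairing_gap0]), and they are rich enough to approximate the
    indicator of any open subset of {|eta| < 1}; hence every Borel subset of
    {|eta| < 1} has measure 0 ([null_gap]). What is left is Sat eta, so if Sat
    eta is finite then m is the combination of impulses with weights m {tau},
    for tau in Sat eta ([concentrated_sum_impulse]).

    Maximality also gives the signs. Damping eta near one saturation point tau,
    and not at the others, keeps it in the unit ball and changes <m, eta>, in
    the limit, by - beta_tau eta(tau), which therefore cannot be positive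
    ([norming_sign]). As eta(tau) is 1 or -1 this fixes the sign of beta_tau,
    and it turns |m| = <m, eta> into |m| = sum of the |beta_tau|
    ([norming_norm]).

    Solutions are convex because the measurements are linear and the norm is
    convex. They are compact because, by the last formula, their weights are
    bounded by the common minimal norm: the solution set is the continuous image
    of a closed subset of a box of R^n ([compact_primal_solutions]). *)

(** * Linearity of the pairing, and impulses *)

Lemma pairing_addr (R : realType) (T : R) (m : measures T)
    (f g : torus T -> R) :
  bmeas f -> bmeas g ->
  pairing m (f \+ g) = pairing m f + pairing m g.
Proof.
move=> bf bg; rewrite /pairing.
have poo := jordan_pos_fin m; have noo := jordan_neg_fin m.
rewrite !RintegralD ?opprD 1?addrACA//; exact: bmeas_integrable.
Qed.

Lemma pairing_scaler (R : realType) (T : R) (m : measures T) (c : R)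
    (f : torus T -> R) :
  bmeas f ->
  pairing m (fun t => c * f t) = c * pairing m f.
Proof.
move=> bf; rewrite /pairing.
have poo := jordan_pos_fin m; have noo := jordan_neg_fin m.
rewrite !RintegralZl ?mulrBr//; exact: bmeas_integrable.
Qed.

Lemma pairing_impulse (R : realType) (T : R) (tau : torus T)
    (f : torus T -> R) :
  bmeas f -> pairing (impulse tau) f = f tau.
Proof.
move=> bf; rewrite (@pairingE _ _ (impulse tau) \d_tau mzero)//=.
- rewrite /Rintegral integral_dirac//; last by apply/measurable_EFinP; case: bf.
  by rewrite integral_measure_zero diracT mul1e subr0.
- by rewrite diracT ltry.
- by rewrite /mzero ltry.
- by move=> A mA; rewrite /mzero sube0 /impulse_fun mem_set// diracE indicE.
Qed.

Lemma pairing_sum_impulse (R : realType) (T : R) (I : Type) (r : seq I)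
    (a : I -> R) (x : I -> torus T) (f : torus T -> R) :
  bmeas f ->
  pairing (\sum_(i <- r) a i *: impulse (x i)) f = \sum_(i <- r) a i * f (x i).
Proof.
move=> bf; elim: r => [|i r IH].
  by rewrite !big_nil -(scale0r (0 : measures T)) pairingZ// mul0r.
by rewrite !big_cons pairingD// IH pairingZ// pairing_impulse.
Qed.

Lemma sum_impulse_apply (R : realType) (T : R) (I : Type) (r : seq I)
    (a : I -> R) (x : I -> torus T) (A : set (torus T)) :
  measurable A ->
  (\sum_(i <- r) a i *: impulse (x i) : measures T) A =
  \sum_(i <- r) a i * \1_A (x i).
Proof.
move=> mA; elim: r => [|i r IH]; first by rewrite !big_nil.
rewrite !big_cons -IH.
by rewrite -[LHS]/(a i * impulse_fun (x i) A + _) /impulse_fun mem_set.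
Qed.

(** * Topology of the torus *)

(** The quotient is defined through membership in a boolean subgroup; this gives
    the explicit multiple of the period. *)
Lemma pi_torusP (R : realType) (T : R) (x y : R) :
  (\pi_(torus T) x = \pi_(torus T) y)%qT <-> exists k : int, x - y = k%:~R * T.
Proof.
pose Q := Quotient.quot (periods T).
have QE : (\pi_Q x == \pi_Q y)%qT = (x - y \in periods T) by rewrite Quotient.idealrBE.
split=> [xy|xy]; last by apply/(eqP : _ == _ :> Q -> _); rewrite QE; apply/asboolP.
have : (\pi_Q x == \pi_Q y)%qT by apply/eqP.
by rewrite QE => /asboolP.
Qed.

(** The torus is the image of the period interval. *)
Lemma torus_compact (R : realType) (T : R) : 0 < T ->
  compact [set: torus T].
Proof.
move=> T_gt0.
have -> : [set: torus T] = (\pi_(torus T) @` `[0, T])%qT.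
  apply/seteqP; split => // t _.
  pose k := Num.floor (repr t / T).
  exists (repr t - k%:~R * T); last first.
    rewrite -[RHS]reprK; apply/pi_torusP; exists (- k).
    by rewrite addrAC subrr add0r mulrNz mulNr.
  rewrite /= in_itv/= subr_ge0 -ler_pdivlMr// ge_floor/=.
  have := floorD1_gt (repr t / T).
  by rewrite ltr_pdivrMr// intrD mulrDl mul1r => /ltW; rewrite lerBlDl.
apply: continuous_compact; last exact: segment_compact.
by apply: continuous_subspaceT; exact: pi_continuous.
Qed.

(** Linearity of the pairing is stated for bounded measurable functions;
    compactness makes it available for all continuous ones. *)
Lemma continuous_bmeas (R : realType) (T : R) (f : torus T -> R) :
  0 < T -> continuous f -> bmeas f.
Proof.
move=> T_gt0 cf; split; first exact: torus_measurable_continuous.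
have : compact (f @` setT).
  by apply: continuous_compact (torus_compact T_gt0); exact: continuous_subspaceT.
move=> /compact_bounded[M [_ MP]]; exists (M + 1) => t.
by apply: (MP (M + 1)); [rewrite ltrDl|exists t].
Qed.

(** A point of the line that is not congruent to tau lies strictly between two
    consecutive representatives of tau, and the open interval between these
    two avoids the whole class of tau. *)
Lemma torus_closed1 (R : realType) (T : R) (tau : torus T) : 0 < T ->
  closed [set tau].
Proof.
move=> T_gt0.
rewrite -[X in closed X]setCK; apply: open_closedC.
rewrite -[open _]/(open (\pi_(torus T) @^-1` (~` [set tau]))%qT).
rewrite openE => x /= xtau.
pose q := (x - repr tau) / T; pose k := Num.floor q.
have xE : x = repr tau + q * T by rewrite /q divfK ?gt_eqF// addrC subrK.
have kq : k%:~R < q.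
  rewrite lt_neqAle ge_floor andbT; apply/eqP => kq; apply: xtau.
  rewrite -[RHS]reprK; apply/pi_torusP; exists k.
  by rewrite kq {1}xE addrAC subrr add0r.
have qk : q < (k + 1)%:~R by exact: floorD1_gt.
have : nbhs x `]repr tau + k%:~R * T, repr tau + (k + 1)%:~R * T[%classic.
  apply: open_nbhs_nbhs; split; first exact: interval_open.
  by rewrite /= in_itv/= {1 2}xE !ltrD2l !ltr_pM2r// kq qk.
apply: filterS => y; rewrite /= in_itv/= => /andP[ky yk].
rewrite -[tau]reprK => /pi_torusP[l yE].
have {}yE : y = repr tau + l%:~R * T by rewrite -yE addrC subrK.
move: ky yk; rewrite yE !ltrD2l !ltr_pM2r//.
by rewrite !ltr_int ltzD1 ltNge => /negPf ->.
Qed.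

Lemma torus_accessible (R : realType) (T : R) : 0 < T ->
  accessible_space (torus T).
Proof.
move=> T_gt0 x y xy; exists (~` [set y]); split.
- exact/closed_openC/torus_closed1.
- by apply/mem_set => /=; exact/eqP.
- by apply/mem_set => /=; exact.
Qed.

Lemma torus_measurable1 (R : realType) (T : R) (tau : torus T) :
  0 < T -> measurable [set tau].
Proof.
move=> T_gt0.
rewrite -[[set tau]]setCK; apply: measurableC; apply: sub_sigma_algebra.
exact/closed_openC/torus_closed1.
Qed.

(** * Support of a measure normed by a function of the unit ball *)

(** Both eta + f / c and eta - f / c stay in the unit ball, where the pairing
    with m is at most |m| = <m, eta>; so <m, f> is neither positive nor
    negative. *)
Lemma pairing_gap0 (R : realType) (T : R) (m : measures T)
    (eta f : torus T -> R) (c : R) :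
  unit_ball eta -> pairing m eta = `|m| ->
  continuous f -> 0 < c -> (forall t, `|f t| <= c * (1 - `|eta t|)) ->
  pairing m f = 0.
Proof.
move=> Beta meta cf c0 fc; have beta := unit_ball_bmeas Beta.1 Beta.2.
have key (b : R) : `|b| = c^-1 -> b * pairing m f <= 0.
  move=> bc.
  have fle t : `|b * f t| <= 1 - `|eta t| by rewrite normrM bc ler_pdivrMl.
  have bf : bmeas f.
    split; first exact: torus_measurable_continuous.
    exists c => t; rewrite (le_trans (fc t))// ler_piMr ?(ltW c0) ?gerBl//.
  have bbf : bmeas (fun t => b * f t).
    split; first by apply: measurable_funM => //; exact: bf.1.
    by exists 1 => t; rewrite (le_trans (fle t))// lerBlDr lerDl.
  have Bef : unit_ball (eta \+ (fun t => b * f t)).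
    split.
      move=> t; apply: continuousD; first exact: Beta.1.
      by apply: continuousM; [exact: cst_continuous|exact: cf].
    apply/supnorm_le1 => t; rewrite (le_trans (ler_normD _ _))//.
    by rewrite -lerBrDl.
  have := pairing_le_tv m Bef.
  by rewrite -[tvnorm m]/(`|m|) pairing_addr// meta gerDl pairing_scaler.
have c1 : 0 < c^-1 by rewrite invr_gt0.
have := key c^-1; rewrite gtr0_norm// => /(_ erefl) h1.
have := key (- c^-1); rewrite normrN gtr0_norm// => /(_ erefl) h2.
apply/eqP; rewrite eq_le -(pmulr_rle0 _ c1) h1/=.
by rewrite -(pmulr_rge0 _ c1) -oppr_le0 -mulNr.
Qed.

(** If phi_k is a sequence in the unit ball tending to the indicator of an open
    set U, then phi_k min(1, k (1 - |eta|)) tends to the indicator of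
    U `&` {|eta| < 1} and pairs to 0 with m by [pairing_gap0]. The two Jordan
    parts of m thus agree on the trace of every open set on {|eta| < 1}, and a
    finite Borel measure is determined by its values on open sets. *)
Lemma null_gap (R : realType) (T : R) (m : measures T) (eta : torus T -> R)
    (A : set (torus T)) :
  unit_ball eta -> pairing m eta = `|m| ->
  measurable A -> m (A `&` [set t | `|eta t| < 1]) = 0.
Proof.
move=> Beta meta mA; set W := [set t | _].
have ceta : continuous (fun t => `|eta t|).
  by move=> t; apply: continuous_comp; [exact: Beta.1|exact: norm_continuous].
have oW : open W.
  by move/continuousP: ceta => /(_ [set x | x < 1]); apply; exact: open_lt.
have mW : measurable W by exact: sub_sigma_algebra.
set p := jordan_pos (hahnP m); set n := jordan_neg (hahnP m).
(* m is the difference of p and n, so it suffices that they agree on W. *)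
suff : mrestr p mW A = mrestr n mW A.
  rewrite /mrestr => pn.
  have := jordanE m (measurableI _ _ mA mW); rewrite -/p -/n pn.
  by rewrite subee ?fin_num_measure//; [case|exact: measurableI].
apply: (@measure_unique _ R (torus T) open (fun=> setT) erefl _ _ _
  (mrestr p mW) (mrestr n mW)) => //.
- exact: openI.
- by move=> _; exact: openT.
- by rewrite bigcup_const.
- move=> U oU; have [phi [Bphi phiU]] := open_bump oU.
  have oUW : open (U `&` W) by exact: openI.
  have mUW : measurable (U `&` W) by exact: sub_sigma_algebra.
  (* The cut-off g k is dominated by k (1 - |eta|) and tends to 1 exactly on W. *)
  pose g (k : nat) t : R := Num.min 1 (k%:R * (1 - `|eta t|)).
  have e0 t : 0 <= 1 - `|eta t| by rewrite subr_ge0; move/supnorm_le1: Beta.2.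
  have g0 k t : 0 <= g k t by rewrite le_min ler01 mulr_ge0.
  have cg k : continuous (g k).
    move=> t; apply: (@continuous_min R (torus T) (cst 1)); first exact: cst_continuous.
    apply: continuousM; first exact: cst_continuous.
    by apply: continuousB; [exact: cst_continuous|exact: ceta].
  have phi1 k t : `|phi k t| <= 1 by have [_ /supnorm_le1] := Bphi k; exact.
  have Bpg k : unit_ball (fun t => phi k t * g k t).
    split.
      by move=> t; apply: continuousM; [exact: (Bphi k).1|exact: cg].
    apply/supnorm_le1 => t; rewrite normrM mulr_ile1// ger0_norm//.
    by rewrite ge_min lexx.
  have pg t : phi k t * g k t @[k --> \oo] --> (\1_(U `&` W) t : R).
    have -> : \1_(U `&` W) t = \1_U t * \1_W t :> R by rewrite indicI.
    apply: cvgM; first exact: phiU.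
    rewrite indicE; case: (boolP (t \in W)) => [/set_mem Wt|tW].
      apply: cvg_near_cst; near=> k; apply/min_l.
      rewrite -ler_pdivrMr ?subr_gt0//; near: k; exact: nbhs_infty_ger.
    rewrite (_ : (fun _ => _) = fun=> 0); first exact: cvg_cst.
    apply/funext => k; rewrite /g; suff -> : 1 - `|eta t| = 0 by rewrite mulr0 min_r.
    apply/eqP; rewrite eq_le e0 andbT subr_le0 leNgt; apply/negP => h.
    by move/negP: tW; apply; exact/mem_set.
  have P0 k : pairing m (fun t => phi k t * g k t) = 0.
    (* k.+1 rather than k, to have a positive constant when k = 0. *)
    apply: (@pairing_gap0 _ _ _ eta _ k.+1%:R) => //; first exact: (Bpg k).1.
    move=> t; rewrite normrM (le_trans (ler_piMl _ _))// ger0_norm//.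
    by rewrite ge_min orbC ler_wpM2r// ler_nat.
  have hp := Rintegral_open (jordan_pos_fin m) oUW Bpg pg.
  have hn := Rintegral_open (jordan_neg_fin m) oUW Bpg pg.
  have pfin : p (U `&` W) \is a fin_num by exact: fin_num_measure.
  have nfin : n (U `&` W) \is a fin_num by exact: fin_num_measure.
  change (p (U `&` W) = n (U `&` W)); rewrite -(fineK pfin) -(fineK nfin).
  congr EFin; apply: (cvg_unique _ hp) => //; apply: cvg_trans hn.
  apply: near_eq_cvg; apply: nearW => k.
  by apply/esym/eqP; rewrite -subr_eq0 -/(pairing m _) P0.
- move=> _; apply: le_lt_trans (jordan_pos_fin m).
  by apply: le_measure; rewrite ?inE//; exact: measurableI.
Unshelve. all: by end_near. Qed.

Lemma SatE (R : realType) (T : R) (eta : torus T -> R) :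
  unit_ball eta -> Sat eta = ~` [set t | `|eta t| < 1].
Proof.
move=> Beta; apply/seteqP; split => t; rewrite /Sat/=.
  by case=> ->; rewrite ?normrN normr1 ltxx.
move=> /negP; rewrite -leNgt => h.
have /eqP : `|eta t| == 1 by rewrite eq_le h andbT; move/supnorm_le1: Beta.2.
by case: (ger0P (eta t)) => _; [left|right; rewrite -[eta t]opprK; congr (- _)].
Qed.

(** A Borel set has the measure of its trace on s, from which additivity peels
    off the points of s one at a time. *)
Lemma concentrated_sum_impulse (R : realType) (T : R) (m : measures T)
    (s : seq (torus T)) :
  0 < T -> uniq s ->
  (forall A, measurable A -> m (A `&` ~` [set` s]) = 0) ->
  m = \sum_(tau <- s) m [set tau] *: impulse tau.
Proof.
move=> T_gt0 us mN.
have m0 : m set0 = 0 by have := charge_of0 m; case.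
have m1 t : measurable [set t : torus T] by exact: torus_measurable1.
have madd A B : measurable A -> measurable B -> m (A `\` B) + m (A `&` B) = m A.
  move=> mA mB.
  have : (m A)%:E = ((m (A `\` B))%:E + (m (A `&` B))%:E)%E.
    exact: (chargeDI (charge_of m) mA mB).
  by case=> ->.
have setc x (u : seq (torus T)) : [set` x :: u] = [set x] `|` [set` u].
  apply/seteqP; split => y; rewrite /= inE; first by case/orP => [/eqP|]; [left|right].
  by case=> [->|->]; rewrite ?eqxx ?orbT.
have ms (u : seq (torus T)) : measurable [set` u].
  elim: u => [|x u IH]; first by rewrite set_nil.
  by rewrite setc; exact: measurableU.
have key (u : seq (torus T)) A : uniq u -> measurable A ->
    m (A `&` [set` u]) = \sum_(tau <- u) m [set tau] * \1_A tau.
  elim: u A => [|x u IH] A.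
    by rewrite set_nil setI0 big_nil m0.
  move=> /= /andP[xu uu] mA; rewrite big_cons -IH// setc.
  rewrite -(madd _ [set x]); [|by apply: measurableI => //; exact: measurableU|by []].
  rewrite addrC; congr (_ + _).
    rewrite -setIA setUK indicE; case: (boolP (x \in A)) => [/set_mem Ax|/negP Ax].
      by rewrite mulr1; congr (m _); apply: setIidr => _ ->.
    rewrite mulr0 -m0; congr (m _).
    by apply/seteqP; split => // y [Ay yx]; apply: Ax; rewrite -yx; exact: mem_set.
  congr (m _); apply/seteqP; split => [y [[Ay [//|uy]] yx]|y [Ay uy]]; first by split.
  split; first by split => //; right.
  by move=> yx; move: xu; rewrite -yx => /negP; apply.
(* Equality of measures includes the sets that are not Borel, where both are 0. *)
apply/val_inj/funext => A.
have [mA|mA] := pselect (measurable A); last first.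
  have nm0 (m' : measures T) : m' A = 0.
    by case: m' => m' m'P /=; have /asboolP[_ + _] := m'P; exact.
  by rewrite -[LHS]/(m A) -[RHS]/((\sum_(tau <- s) _ : measures T) A) !nm0.
rewrite -[LHS]/(m A) -[RHS]/((\sum_(tau <- s) _ : measures T) A).
rewrite sum_impulse_apply// -key// -(madd A [set` s])// setDE.
by rewrite mN// add0r.
Qed.

(** * Signs and norm of a normed combination of impulses *)

(** Let b_n tend to the indicator of an open set that contains tau and no other
    point of s. As eta (1 - b_n^2) is in the unit ball, <m, eta b_n^2> >= 0, and
    this number tends to a tau * eta tau. The square is there because b_n itself
    may be negative. *)
Lemma norming_sign (R : realType) (T : R) (m : measures T)
    (eta : torus T -> R) (s : seq (torus T)) (a : torus T -> R) (tau : torus T) :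
  0 < T ->
  unit_ball eta -> pairing m eta = `|m| -> uniq s ->
  m = \sum_(sigma <- s) a sigma *: impulse sigma ->
  tau \in s -> 0 <= a tau * eta tau.
Proof.
move=> T_gt0 Beta meta us mE taus.
pose U := ~` [set` rem tau s].
have oU : open U.
  apply: closed_openC; move: (torus_accessible T_gt0).
  by rewrite accessible_finite_set_closed; apply; exact: finite_seq.
have [b [Bb bU]] := open_bump oU.
have b1 n t : `|b n t| <= 1 by have [_ /supnorm_le1] := Bb n; exact.
have bb n t : 0 <= 1 - b n t * b n t <= 1.
  rewrite subr_ge0 lerBlDr lerDl -expr2 sqr_ge0 andbT.
  by rewrite -real_normK ?num_real// expr_le1.
have Bphi n : unit_ball (fun t => eta t * (1 - b n t * b n t)).
  split; last first.
    apply/supnorm_le1 => t; have /andP[? ?] := bb n t.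
    rewrite normrM mulr_ile1//; last by rewrite ger0_norm.
    by move/supnorm_le1: Beta.2.
  move=> t; apply: (continuousM (s := eta)); first exact: Beta.1.
  apply: continuousB; first exact: cst_continuous.
  by apply: continuousM; exact: (Bb n).1.
have n0 n : 0 <= \sum_(sigma <- s) a sigma * eta sigma * (b n sigma * b n sigma).
  have := pairing_le_tv m (Bphi n).
  rewrite -[tvnorm m]/(`|m|) -meta [in X in X -> _]mE.
  rewrite !pairing_sum_impulse; [|exact: unit_ball_bmeas Beta.1 Beta.2|
    exact: unit_ball_bmeas (Bphi n).1 (Bphi n).2].
  rewrite -subr_ge0 -sumrB; congr (0 <= _); apply: eq_bigr => i _.
  ring.
have lim : (\sum_(sigma <- s) a sigma * eta sigma * (b n sigma * b n sigma))
    @[n --> \oo] --> \sum_(sigma <- s) a sigma * eta sigma * (\1_U sigma * \1_U sigma).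
  apply: cvg_big => [|sigma _]; first exact: add_continuous.
  by apply: cvgM; [exact: cvg_cst|apply: cvgM; exact: bU].
have : 0 <= \sum_(sigma <- s) a sigma * eta sigma * (\1_U sigma * \1_U sigma).
  by apply: (cvgr_to_ge lim); exact: nearW.
rewrite (perm_big _ (perm_to_rem taus))/= big_cons big_seq big1 => [|sigma rs].
  rewrite addr0 indicE mem_set ?mulr1// /U/=.
  by rewrite mem_rem_uniq// inE eqxx.
by rewrite indicE memNset ?mulr0// => /(_ rs).
Qed.

(** By [norming_sign] every term of <m, eta> is nonnegative, hence equal to its
    absolute value, and |eta| = 1 at every point of s. *)
Lemma norming_norm (R : realType) (T : R) (m : measures T)
    (eta : torus T -> R) (s : seq (torus T)) (a : torus T -> R) :
  0 < T ->
  unit_ball eta -> pairing m eta = `|m| -> uniq s -> {subset s <= Sat eta} ->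
  m = \sum_(sigma <- s) a sigma *: impulse sigma ->
  `|m| = \sum_(sigma <- s) `|a sigma|.
Proof.
move=> T_gt0 Beta meta us sSat mE; rewrite -meta {1}mE pairing_sum_impulse; last first.
  exact: unit_ball_bmeas Beta.1 Beta.2.
rewrite big_seq [RHS]big_seq; apply: eq_bigr => sigma ss.
rewrite -[LHS]ger0_norm; last exact: norming_sign mE ss.
rewrite normrM; have /set_mem[->|->] := sSat _ ss.
  by rewrite normr1 mulr1.
by rewrite normrN normr1 mulr1.
Qed.

(** * Geometry of the solution set *)

Lemma translated_bmeas (R : realType) (T : R) (psi : torus T -> R)
    (tau : torus T) :
  0 < T -> continuous psi -> bmeas (fun t => psi (tau - t)).
Proof.
move=> T_gt0 psi_cont.
apply: continuous_bmeas => //; apply/quotient_continuous.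
rewrite [X in continuous X](_ : _ = unroll psi \o (fun x => repr tau - x)).
  move=> x; apply: continuous_comp.
    by apply: continuousB; [exact: cst_continuous|exact: cvg_id].
  by move: (repr tau - x); apply/quotient_continuous.
by apply/funext => x; rewrite /unroll/= pi_torusB reprK.
Qed.

Lemma convex_primal_solutions (R : realType) (T : R) (L : nat)
    (psi : torus T -> R) (theta : 'I_L -> torus T) (y0 : 'rV[R]_L) :
  0 < T -> continuous psi -> convex_set (primal_solutions psi theta y0).
Proof.
move=> T_gt0 psi_cont m1 m2 k /set_mem[m1y m1n] /set_mem[m2y m2n]; apply/mem_set.
rewrite -[conv k m1 m2]/(k%:num *: m1 + (1 - k%:num) *: m2).
have k0 : 0 <= k%:num by [].
have k1 : 0 <= 1 - k%:num by rewrite subr_ge0.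
split.
  apply/rowP => l; rewrite mxE pairingD ?pairingZ; try exact: translated_bmeas.
  have /rowP/(_ l) := m1y; have /rowP/(_ l) := m2y; rewrite !mxE => -> ->.
  by rewrite -mulrDl addrC subrK mul1r.
move=> m' m'y; rewrite (le_trans (ler_normD _ _))// !normrZ !ger0_norm//.
rewrite [leRHS](_ : _ = k%:num * `|m'| + (1 - k%:num) * `|m'|); last by ring.
by rewrite lerD// ler_wpM2l ?m1n ?m2n.
Qed.

(** The weights of the solutions form a closed set of R^n, because the
    measurements and the norm are continuous functions of the weights; the bound
    M puts this set in a cube, and the solution set is its continuous image. *)
Lemma compact_primal_solutions (R : realType) (T : R) (L : nat)
    (psi : torus T -> R) (theta : 'I_L -> torus T) (y0 : 'rV[R]_L)
    (n : nat) (x : 'I_n -> torus T) (M : R) :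
  let sols := primal_solutions psi theta y0 in
  0 < T -> continuous psi -> injective x ->
  (forall m, sols m -> m = \sum_(i < n) m [set x i] *: impulse (x i)) ->
  (forall m i, sols m -> `|m [set x i]| <= M) ->
  compact sols.
Proof.
move=> sols T_gt0 psi_cont xinj solE solM.
pose J (v : 'rV[R]_n) : measures T := \sum_(i < n) v 0 i *: impulse (x i).
have cJ : continuous J.
  apply: continuous_big => [|i _]; first exact: add_continuous.
  by move=> v; apply: cvgZr_tmp; [exact: nbhs_filter|exact: coord_continuous].
(* This transfers the bound M from the solutions to their weight vectors. *)
have JE v i : J v [set x i] = v 0 i.
  rewrite /J sum_impulse_apply; last exact: torus_measurable1.
  rewrite (bigD1 i)//= indicE mem_set// mulr1 big1 ?addr0// => j ji.
  by rewrite indicE memNset ?mulr0//= => /xinj/eqP; exact/negP.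
have -> : sols = J @` [set v | sols (J v)].
  apply/seteqP; split=> [m ms|_ [v + <-]//].
  exists (\row_i m [set x i]); last first.
    by rewrite [RHS]solE//; apply: eq_bigr => i _; rewrite mxE.
  rewrite /= (_ : J _ = m)// [RHS]solE//.
  by apply: eq_bigr => i _; rewrite mxE.
apply: continuous_compact; first exact: continuous_subspaceT.
apply: (@subclosed_compact _ _ [set v : 'rV[R]_n | forall i, `[- M, M]%classic (v 0 i)]).
- have -> : [set v | sols (J v)] =
      (\bigcap_(l in setT) [set v | Phi psi theta (J v) 0 l = y0 0 l]) `&`
      (\bigcap_(m' in [set m' | Phi psi theta m' = y0]) [set v | `|J v| <= `|m'|]).
    apply/seteqP; split=> v /=.
      by move=> [Jy Jn]; split=> [l _|m' /=]; [rewrite /= Jy|exact: Jn].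
    by move=> [Jy Jn]; split; [apply/rowP => l; exact: Jy|exact: Jn].
  apply: closedI.
    apply: closed_bigI => l _.
    have cPhi : continuous (fun v => Phi psi theta (J v) 0 l).
      rewrite [X in continuous X](_ : _ = fun v : 'rV[R]_n =>
        \sum_(i < n) v 0 i * psi (theta l - x i)).
        apply: continuous_big => [|i _]; first exact: add_continuous.
        by move=> v; apply: continuousM; [exact: coord_continuous|exact: cst_continuous].
      by apply/funext => v; rewrite mxE pairing_sum_impulse//; exact: translated_bmeas.
    by move/continuous_closedP : cPhi => /(_ _ (@closed_eq _ (y0 0 l))).
  apply: closed_bigI => m' _.
  have cN : continuous (fun v => `|J v|).
    by move=> v; apply: continuous_comp; [exact: cJ|exact: norm_continuous].
  by move/continuous_closedP : cN => /(_ _ (@closed_le _ `|m'|)).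
- by apply: (@rV_compact _ _ (fun=> `[- M, M]%classic)) => _; exact: segment_compact.
- move=> v /= vs i; rewrite in_itv/= -ler_norml -JE; exact: solM.
Qed.

(** * The theorem *)

Theorem mainTheorem2 (R : realType) (T : R) (T_gt0 : 0 < T)
    (D : {linear pgf T -> pgf T}) (D_cont : continuous D)
    (D_inv : bijective D) (D_lsi : shift_invariant D)
    (psi : torus T -> R) (psi_cont : continuous psi) (psi_green : is_green D psi)
    (L : nat) (theta : 'I_L -> torus T)
    (m0 : measures T) (y0 : 'rV[R]_L) (y0E : y0 = Phi psi theta m0)
    (eta : torus T -> R) (eta_cert : dual_certificate psi theta y0 eta)
    (Sat_fin : finite_set (Sat eta)) :
  [/\ forall m, primal_solutions psi theta y0 m ->
        exists (n : nat) (tau : 'I_n -> torus T) (a : 'I_n -> R),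
          [/\ (n <= #|` fset_set (Sat eta)|)%N, injective tau,
              forall i, a i != 0 & m = \sum_(i < n) a i *: impulse (tau i)],
      primal_solutions psi theta y0 `<=`
        lin_span [set impulse tau | tau in Sat eta],
      convex_set (primal_solutions psi theta y0),
      compact (primal_solutions psi theta y0) &
      forall m (beta : torus T -> R), primal_solutions psi theta y0 m ->
        m = \sum_(tau \in Sat eta) beta tau *: impulse tau ->
        forall tau, Sat eta tau -> beta tau != 0 ->
          Num.sg (beta tau) = eta tau /\ (eta tau = -1 \/ eta tau = 1)].
Proof.
have [ceta _ eta1 eta_dual] := eta_cert; have Beta : unit_ball eta by [].
pose s : seq (torus T) := fset_set (Sat eta).
have us : uniq s by exact: fset_uniq.
have sSat : [set` s] = Sat eta by exact: fset_setK.
have ssub : {subset s <= Sat eta}.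
  by move=> t ts; apply/mem_set; rewrite -sSat.
have solE m : primal_solutions psi theta y0 m ->
    m = \sum_(tau <- s) m [set tau] *: impulse tau.
  move=> msol; apply: concentrated_sum_impulse => // A mA.
  by rewrite sSat SatE// setCK; apply: null_gap => //; exact: eta_dual.
split.
- move=> m /solE; set s' := [seq tau <- s | m [set tau] != 0] => mE.
  exists (size s'), (tnth (in_tuple s')), (fun i => m [set tnth (in_tuple s') i]).
  split.
  + by rewrite size_filter count_size.
  + by apply/tuple_uniqP; exact: filter_uniq.
  + by move=> i; have := mem_tnth i (in_tuple s'); rewrite mem_filter => /andP[].
  + rewrite {1}mE -(big_tnth _ _ _ predT (fun tau => m [set tau] *: impulse tau)).
    rewrite big_filter [RHS]big_mkcond; apply: eq_bigr => tau _.
    by case: eqP => [->|//]; rewrite scale0r.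
- move=> m /solE mE; exists (size s), (fun i => m [set tnth (in_tuple s) i]).
  exists (fun i => impulse (tnth (in_tuple s) i)); split.
    move=> i; exists (tnth (in_tuple s) i) => //.
    by rewrite -sSat /=; exact: mem_tnth.
  by rewrite {1}mE -(big_tnth _ _ _ predT (fun tau => m [set tau] *: impulse tau)).
- exact: convex_primal_solutions.
- apply: (@compact_primal_solutions _ _ _ _ _ _ _ (tnth (in_tuple s)) `|m0|) => //.
  + exact/tuple_uniqP.
  + move=> m /solE mE; rewrite {1}mE.
    by rewrite -(big_tnth _ _ _ predT (fun tau => m [set tau] *: impulse tau)).
  + move=> m i msol; have [_ m_min] := msol.
    apply: le_trans (m_min m0 (esym y0E)).
    rewrite (norming_norm T_gt0 Beta (eta_dual _ msol) us ssub (solE _ msol)).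
    rewrite (perm_big _ (perm_to_rem (mem_tnth i (in_tuple s))))/= big_cons.
    by rewrite lerDl sumr_ge0.
- move=> m beta msol mE tau Stau bneq0.
  move: mE; rewrite fsbig_finite// -/s => mE.
  have taus : tau \in s by move: Stau; rewrite -sSat.
  have := norming_sign T_gt0 Beta (eta_dual _ msol) us mE taus.
  case: Stau => ->; rewrite ?mulrN mulr1 ?oppr_ge0 => b0.
    by split; [apply: gtr0_sg; rewrite lt_neqAle eq_sym bneq0|right].
  by split; [apply: ltr0_sg; rewrite lt_neqAle bneq0|left].
Qed.
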